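(* Let $G$ be a finite group containing two subgroups $U$ and $V$ which together generate $G$. Consider the conditions (a) $U\cong D_3$, $V\cong D_2$, and $U\cap V\cong\mathbf{Z}/2\mathbf{Z}$; (b) $U\cong D_3$, $V\cong A_4$, and $U\cap V\cong\mathbf{Z}/3\mathbf{Z}$. Then (1) if $|G|=48$ and (a) holds, $G\cong S_4\times\mathbf{Z}/2\mathbf{Z}$, whereas if $|G|=48$ then (b) cannot hold; (2) there is no group $G$ with $|G|=72$ for which (a) or (b) holds.
   Context: $D_n$ denotes the dihedral group of order $2n$ (so $D_2\cong(\mathbf{Z}/2\mathbf{Z})^2$ and $D_3\cong S_3$). *)

(* Defs.v *)
From HB Require Import structures.
From mathcomp Require Import all_boot all_algebra all_fingroup all_solvable.
Set Implicit Arguments. Unset Strict Implicit. Unset Printing Implicit Defensive.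
Local Open Scope group_scope.

(* Paper's D_n (order 2n) is MathComp's 'D_(2n): D_3 = 'D_6, D_2 = 'D_4. *)
Definition cond_a (gT : finGroupType) (U V : {group gT}) : Prop :=
  [/\ U \isog 'D_6, V \isog 'D_4 & (U :&: V)%G \isog Zp 2].
Definition cond_b (gT : finGroupType) (U V : {group gT}) : Prop :=
  [/\ U \isog 'D_6, V \isog 'Alt_('I_4) & (U :&: V)%G \isog Zp 3].

(* Main.v *)
Require Import Defs.
From HB Require Import structures.
From mathcomp Require Import all_boot all_algebra all_fingroup all_solvable.
Set Implicit Arguments. Unset Strict Implicit. Unset Printing Implicit Defensive.
Local Open Scope group_scope.

(** Write [U = <c, t>] with [c] of order 3 inverted by the involution [t]; a
    normal subgroup containing [t] contains [c].  If [G] is generated by [U] and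
    [V], and [W] is normal in [G] with [V] inside [U W], then [|G| <= |U| |W|],
    and almost every configuration is refuted by exhibiting such a small [W].

    In order 48, intersecting two Sylow 2-subgroups gives a normal subgroup [K]
    of order 8.  Under (b), the Klein group [W] of [V] lies in [K], meets [W^t]
    nontrivially, and is [c]-irreducible, so it is normal and [|G| <= 24].  Under
    (a), [V = <t, w>] with [w] in [K]; since [c] moves the involution [w], [K] is
    abelian, [G = ([K, c] U) x C_K(c)], and [[K, c] U] acts faithfully on the
    four cosets of [U].

    In order 72, either a Sylow 3-subgroup is normal or two of them meet in a
    normal subgroup [L] of order 3 whose centralizer [C] has index at most 2.
    Under (b), the Klein group of [V] is characteristic in [V x L], which has
    index 2.  Under (a), Gaschutz's theorem gives [C = L x M]: if [C = G] all
    involutions lie in [M]; otherwise [|M| = 12], and [M] has a normal Sylow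
    subgroup, which yields a normal subgroup of [G] of order 9 or 4. *)

(** * Normal subgroups in groups of order 48, 72 and 12 *)

Section SmallOrders.

Variable gT : finGroupType.
Implicit Types (G H K L M P S W X : {group gT}) (x : gT).

Lemma card_mulG_le G H K :
  H \subset G -> K \subset G -> #|H| * #|K| <= #|G| * #|H :&: K|.
Proof.
by move=> sHG sKG; rewrite mul_cardG leq_mul2r subset_leq_card ?mul_subG ?orbT.
Qed.

(** Distinct Sylow subgroups [S] and [S :^ x] satisfy 16 * 16 <= 48 * |D|, so [D] has index 2 in
    both. The normalizer of [D] then has order a multiple of 16 dividing 48 and strictly contains
    [S], so it is [G]. *)
Lemma order48_normal_2subgroup G : #|G| = 48 ->
  (exists2 S : {group gT}, S <| G & #|S| = 16) \/
  (exists2 K : {group gT}, K <| G & #|K| = 8).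
Proof.
move=> oG; have [S sylS] := Sylow_exists 2 G; have sSG := pHall_sub sylS.
have oS : #|S| = 16 by rewrite (card_Hall sylS) oG p_part.
have [nSG | nnSG] := boolP (S <| G); first by left; exists S.
right; have /subsetPn[x Gx nSx] : ~~ (G \subset 'N(S)).
  by move: nnSG; rewrite /normal sSG.
have sSxG : S :^ x \subset G by rewrite -(conjGid Gx) conjSg.
have neS : S :^ x != S by apply: contra nSx => /eqP eS; rewrite inE eS.
pose D := (S :&: S :^ x)%G.
have oSx : #|(S :^ x)%G| = 16 by rewrite cardJg.
have sDS : D \subset S by apply: subsetIl.
have sDSx : D \subset (S :^ x)%G by apply: subsetIr.
have oD : #|D| = 8.
  have := @card_mulG_le G S (S :^ x)%G sSG sSxG; rewrite oS oSx oG /= => leD.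
  have := cardSg sDS; rewrite oS => /(dvdn_pfactor _ 4 (isT : prime 2))[n le_n4 oDn].
  have: #|D| != 16.
    apply: contra neS => /eqP oD; rewrite eq_sym eqEcard cardJg leqnn andbT.
    have eDS : D :=: S by apply/eqP; rewrite eqEcard sDS oS oD.
    by rewrite -{1}eDS; apply: subsetIr.
  by case: n le_n4 oDn leD => [|[|[|[|[|n]]]]] // _; rewrite /D /= => ->.
have nDS : D <| S.
  by apply: index2_normal => //; rewrite -divgS // oS oD.
have nDSx : D <| (S :^ x)%G.
  by apply: index2_normal => //; rewrite -divgS // oSx oD.
exists D; rewrite // /normal (subset_trans sDS) //=.
have sSN : S \subset 'N_G(D) by rewrite subsetI sSG normal_norm.
have sSxN : S :^ x \subset 'N_G(D) by rewrite subsetI sSxG normal_norm.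
have /dvdnP[k oN] := cardSg sSN; have := cardSg (subsetIl G 'N(D)).
rewrite oN oG oS -[48]/(3 * 16)%N dvdn_pmul2r // => /(@dvdn_leq k 3 isT).
case: k oN => [|[|[|[|k]]]] // oN _; rewrite oS in oN.
- by have:= cardG_gt0 'N_G(D); rewrite oN.
- have eS : S :=: 'N_G(D) by apply/eqP; rewrite eqEcard sSN oS oN.
  by case/eqP: neS; apply/eqP; rewrite eqEcard cardJg leqnn -eS in sSxN *; rewrite sSxN.
- by have := cardSg (subsetIl G 'N(D)); rewrite oN oG.
have eG : 'N_G(D) = G by apply/eqP; rewrite eqEcard subsetIl oN oG.
by rewrite -{1}eG subsetIr.
Qed.

(** From 9 * 9 <= 72 * |L|, distinct Sylow subgroups meet in [L] of order 3. Groups of order 9 are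
    abelian, so the centralizer of [L] contains both; [P] is not normal in it, hence has index
    neither 1 nor 2 there, which leaves order 36 or 72. *)
Lemma order72_normal_3subgroup G : #|G| = 72 ->
  (exists2 P : {group gT}, P <| G & #|P| = 9) \/
  (exists L : {group gT}, [/\ L <| G, #|L| = 3, 'C_G(L) <| G &
                            #|'C_G(L)| = 36 \/ #|'C_G(L)| = 72]).
Proof.
move=> oG; have [P sylP] := Sylow_exists 3 G; have sPG := pHall_sub sylP.
have oP : #|P| = 9 by rewrite (card_Hall sylP) oG p_part.
have [nPG | nnPG] := boolP (P <| G); first by left; exists P.
right; have /subsetPn[x Gx nPx] : ~~ (G \subset 'N(P)).
  by move: nnPG; rewrite /normal sPG.
have sPxG : P :^ x \subset G by rewrite -(conjGid Gx) conjSg.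
have neP : P :^ x != P by apply: contra nPx => /eqP eP; rewrite inE eP.
pose L := (P :&: P :^ x)%G.
have oPx : #|(P :^ x)%G| = 9 by rewrite cardJg.
have sLP : L \subset P by apply: subsetIl.
have sLPx : L \subset (P :^ x)%G by apply: subsetIr.
have oL : #|L| = 3.
  have := @card_mulG_le G P (P :^ x)%G sPG sPxG; rewrite oP oPx oG /= => leD.
  have := cardSg sLP; rewrite oP => /(dvdn_pfactor _ 2 (isT : prime 3))[n le_n oLn].
  have: #|L| != 9.
    apply: contra neP => /eqP oL; rewrite eq_sym eqEcard cardJg leqnn andbT.
    have eLP : L :=: P by apply/eqP; rewrite eqEcard sLP oP oL.
    by rewrite -{1}eLP; apply: subsetIr.
  by case: n le_n oLn leD => [|[|[|n]]] // _; rewrite /L /= => ->.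
have cPL : P \subset 'C_G(L).
  rewrite subsetI sPG; apply: (centsS sLP); rewrite -/(abelian P).
  exact: (@card_p2group_abelian _ 3).
have cPxL : P :^ x \subset 'C_G(L).
  rewrite subsetI sPxG; apply: (centsS sLPx).
  exact: (@card_p2group_abelian _ 3 (P :^ x)%G).
pose C := 'C_G(L)%G; have sCG : C \subset G by apply: subsetIl.
have sylPC : 3.-Sylow(C) P by apply: pHall_subl cPL sCG sylP.
have sylPxC : 3.-Sylow(C) (P :^ x)%G.
  by apply: pHall_subl cPxL sCG _; rewrite pHallJ.
have nPC : ~~ (P <| C).
  apply/negP => nPC; case/eqP: neP; apply/eqP.
  rewrite eqEcard cardJg leqnn andbT.
  by rewrite (sub_normal_Hall sylPC nPC cPxL) (pHall_pgroup sylPxC).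
have oC : #|C| = 36 \/ #|C| = 72.
  have /dvdnP[k oC] := cardSg cPL; have := cardSg sCG.
  move: (oC); rewrite oP => oC9.
  rewrite oC9 oG -[72]/(8 * 9)%N dvdn_pmul2r // => k8.
  have kcases : k \in divisors 8 by rewrite -dvdn_divisors.
  move: kcases; rewrite (_ : divisors 8 = [:: 1; 2; 4; 8]%N) // !inE.
  case/or4P=> /eqP ek; rewrite ek in oC9 *; [exfalso | exfalso | by left | by right].
    have eP : P :=: C by apply/eqP; rewrite eqEcard cPL oP oC9.
    by rewrite eP normal_refl in nPC.
  by rewrite index2_normal // -?divgS ?oP ?oC9 in nPC.
have nCG : C <| G.
  case: oC => oC; first by apply: index2_normal; rewrite // -divgS // oG oC.
  have -> : C :=: G by apply/eqP; rewrite eqEcard sCG oC oG.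
  exact: normal_refl.
exists L; split=> //.
(* [L] is a normal 3-subgroup of [C], and the 3-core lies in both Sylow subgroups, hence in their
   intersection [L]. So [L] is characteristic in [C]. *)
suff -> : L :=: 'O_3(C) by apply: gFnormal_trans nCG.
apply/eqP; rewrite eqEsubset; apply/andP; split; last first.
  by rewrite subsetI !pcore_sub_Hall.
apply: pcore_max; first by rewrite /pgroup oL.
by rewrite /normal (subset_trans sLP) //= cents_norm // subsetIr.
Qed.

(** If [P] is not normal it is self-normalizing, so its conjugates account for 8 elements of order
    3. A Sylow 2-subgroup must be the set of the 4 remaining elements, and that set is invariant
    under conjugation. *)
Lemma order12_normal_Sylow M : #|M| = 12 ->
  (exists2 P : {group gT}, P <| M & #|P| = 3) \/
  (exists2 W : {group gT}, W <| M & #|W| = 4).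
Proof.
move=> oM; have [P sylP] := Sylow_exists 3 M; have sPM := pHall_sub sylP.
have oP : #|P| = 3 by rewrite (card_Hall sylP) oM p_part.
have [nPM | nPM] := boolP (P <| M); [by left; exists P | right].
have [W sylW] := Sylow_exists 2 M; have sWM := pHall_sub sylW.
have oW : #|W| = 4 by rewrite (card_Hall sylW) oM p_part.
exists W => //.
have NP : 'N_M(P) = P.
  have sPN : P \subset 'N_M(P) by rewrite subsetI sPM normG.
  have /dvdnP[k] := cardSg sPN; rewrite oP => oN; have := cardSg (subsetIl M 'N(P)).
  rewrite oN oM -[12]/(4 * 3)%N dvdn_pmul2r // => k4.
  (* With [k] the index of [P] in its normalizer, there are 4 / k Sylow 3-subgroups; the congruence
     modulo 3 excludes [k] = 2. *)
  have n3 := card_Syl_mod M (isT : prime 3); rewrite (card_Syl sylP) in n3.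
  rewrite -divgS ?subsetIl // oM oN in n3.
  have : k \in divisors 4 by rewrite -dvdn_divisors.
  rewrite (_ : divisors 4 = [:: 1; 2; 4]%N) // !inE.
  case/or3P=> /eqP ek; rewrite ek in oN n3; [|by []|].
    by apply/eqP; rewrite eq_sym eqEcard sPN oP oN.
  case/negP: nPM; have <- : 'N_M(P) = M by apply/eqP; rewrite eqEcard subsetIl oN oM.
  by rewrite /normal sPN subsetIr.
have TI : normedTI P^# M P.
  apply/normedTI_P; rewrite setD_eq0 subG1 trivg_card1 oP; split=> //.
    by rewrite normD1 -{1}NP.
  move=> x Mx; rewrite -setI_eq0 => nTI; rewrite -NP inE Mx inE.
  have: P :&: P :^ x != 1.
    by apply: contra nTI => /eqP tI; rewrite conjD1g -setDIl tI setDv.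
  move/prime_meetG; rewrite oP => /(_ isT) sPPx.
  have /eqP ePx : P :==: P :^ x by rewrite eqEcard sPPx cardJg /=.
  by rewrite -ePx /=.
have oA : #|class_support P^# M| = 8.
  have oP1 : #|P^#| = 2 by move: oP; rewrite (cardsD1 1) group1 => -[].
  by rewrite (card_support_normedTI TI) -divgS // oM oP oP1.
have -> : W :=: M :\: class_support P^# M.
  apply/eqP; rewrite eqEcard; apply/andP; split.
    rewrite subsetD sWM -setI_eq0; apply/set0Pn=> [[y /setIP[Wy]]].
    case/imset2P=> z g /setD1P[ntz Pz] Mg defy.
    have := order_dvdG Wy; rewrite defy orderJ oW => z4.
    have := order_dvdG Pz; rewrite oP => z3.
    case/eqP: ntz; apply/eqP; rewrite -order_eq1 -dvdn1 -(eqP (isT : coprime 3 4)).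
    by rewrite dvdn_gcd z3.
  rewrite cardsD oM (setIidPr _) ?oA ?oW //.
  by rewrite class_support_subG ?(subset_trans (subD1set _ _)).
rewrite /normal subsetDl normsD ?normG ?class_support_norm //.
Qed.

Lemma cyclic_generator_prime H p : prime p -> #|H| = p ->
  exists2 x, x \in H & #[x] = p.
Proof.
move=> pr_p oH; have /cyclicP[x defH] : cyclic H by rewrite prime_cyclic ?oH.
by exists x; rewrite ?orderE -?defH // defH cycle_id.
Qed.

Lemma norm_order2_cent X (A : {set gT}) :
  #|X| = 2 -> A \subset 'N(X) -> A \subset 'C(X).
Proof.
move=> oX /subsetP nXA; have [x Xx ox] := cyclic_generator_prime (isT : prime 2) oX.
have ntx : x != 1 by rewrite -order_eq1 ox.
have defX : X :=: [set 1; x].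
  by apply/eqP; rewrite eq_sym eqEcard oX cards2 subUset !sub1set group1 Xx (eq_sym 1) ntx.
apply/subsetP=> a Aa; apply/centP=> y; rewrite defX !inE => /pred2P[] ->.
  by rewrite /commute mulg1 mul1g.
apply/esym; rewrite /commute conjgC; congr (_ * _).
have: x ^ a \in X by rewrite memJ_norm ?nXA.
by rewrite defX !inE conjg_eq1 (negPf ntx) => /eqP.
Qed.

End SmallOrders.

(** * Generators of the dihedral group of order 6 *)

Section Dihedral6.

Variable gT : finGroupType.
Implicit Types (N U : {group gT}) (c t : gT).

Lemma dihedral6_card U : U \isog 'D_6 -> #|U| = 6.
Proof. by move/card_isog->; rewrite (@card_dihedral 3). Qed.

Lemma dihedral6_nonabelian U : U \isog 'D_6 -> ~~ abelian U.
Proof.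
move=> isoU; have oU := dihedral6_card isoU.
move: isoU => /(isoGrpP _ (@Grp_dihedral 3 isT))[_ /existsP[[x y]] /=].
case/eqP=> defU x3 y2 xy; apply/negP=> cUU.
have Ux : x \in U by rewrite -defU mem_gen // inE cycle_id.
have Uy : y \in U by rewrite -defU mem_gen // inE cycle_id orbT.
have xyx : x ^ y = x by apply/conjg_fixP/commgP/(centsP cUU).
have x1 : x = 1.
  have x2 : x ^+ 2 = 1 by rewrite expgS expg1 -{2}xyx xy mulgV.
  by move: x3; rewrite expgS x2 mulg1.
have := subset_leq_card (_ : U \subset <[y]>); rewrite oU.
rewrite -{1}defU join_subG subxx x1 cycle1 sub1G => /(_ isT).
have /(dvdn_leq (isT : 0 < 2)) : #[y] %| 2 by rewrite order_dvdn y2.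
by rewrite orderE => le2 /leq_trans/(_ le2).
Qed.

(** [<[c]>] has index 2, so [c ^ t] is a power of [c]. Exponent 0 would make [c] trivial and
    exponent 1 would make [U] abelian, so only the inverse remains. *)
Lemma dihedral6_gen U c t :
    U \isog 'D_6 -> c \in U -> t \in U -> #[c] = 3 -> #[t] = 2 ->
  <[c]> * <[t]> = U /\ c ^ t = c^-1.
Proof.
move=> isoU Uc Ut oc ot; have oU := dihedral6_card isoU.
have tiC : <[c]> :&: <[t]> = 1.
  by apply: coprime_TIg; rewrite -!orderE oc ot.
have defU : <[c]> * <[t]> = U.
  apply/eqP; rewrite eqEcard mul_subG ?cycle_subG //=.
  by rewrite (TI_cardMg tiC) -!orderE oc ot oU.
split=> //; have nC : <[c]> <| U.
  by apply: index2_normal; rewrite ?cycle_subG // -divgS ?cycle_subG // -orderE oc oU.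
have : c ^ t \in <[c]> by rewrite memJ_norm ?cycle_id // (subsetP (normal_norm nC)).
case/cycleP=> k; have := expg_mod_order c k; rewrite oc => <-.
have := ltn_pmod k (isT : 0 < 3); case: (k %% 3) => [|[|[|]]] // _ ct.
- have := order_eq1 c; rewrite oc -(conjg_eq1 c t) ct expg0 eqxx //.
- case/negP: (dihedral6_nonabelian isoU); rewrite -defU abelianM !cycle_abelian /=.
  rewrite cent_cycle cycle_subG 1?cent1C; apply/cent1P/commgP/conjg_fixP.
  by rewrite ct expg1.
by rewrite ct; apply/eqP; rewrite eq_sym eq_invg_mul -expgS -oc expg_order.
Qed.

(** The commutator of [t] and [c] lies in [N] and equals [c ^+ 2], which generates [<[c]>]. *)
Lemma normal_inverting_mem c t N :
  #[c] = 3 -> c ^ t = c^-1 -> c \in 'N(N) -> t \in N -> c \in N.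
Proof.
move=> oc ct nNc Nt.
have Nc2 : c ^+ 2 \in N.
  have -> : c ^+ 2 = t^-1 * t ^ c by rewrite -commgEl commgEr conjVg ct invgK.
  by rewrite groupM ?groupV // memJ_norm.
have -> : c = (c ^+ 2) ^+ 2 by rewrite -expgM -(expg_mod_order c 4) oc expg1.
exact: groupX.
Qed.

End Dihedral6.

(** * The alternating group of degree 4: trivial center and Klein subgroup *)

Section Alt4.

Lemma center_Alt4 : 'Z('Alt_('I_4)) = 1.
Proof.
apply/trivgP/subsetP=> s /centerP[As cs]; apply/set1P/permP=> a; rewrite perm1.
apply/eqP/negPn/negP=> nsa.
have /cards2P[x [y [xy exy]]] : #|~: [set a; s a]| == 2.
  by rewrite cardsCs setCK card_ord cards2 (eq_sym a) nsa.
have /[!inE]/norP[xa xs] : x \in ~: [set a; s a] by rewrite exy !inE eqxx.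
have /[!inE]/norP[ya ys] : y \in ~: [set a; s a] by rewrite exy !inE eqxx orbT.
(* A 3-cycle on [a] and the two points [x], [y] outside [a] and [s a]: it fixes [s a] but moves [a],
   so it cannot commute with [s]. *)
pose r := tperm a x * tperm a y.
have Ar : r \in 'Alt_('I_4).
  by rewrite Alt_even odd_permM !odd_tperm !(eq_sym a) xa ya.
have ra : r a = x by rewrite permM tpermL tpermD // eq_sym.
have rs : r (s a) = s a by rewrite permM !tpermD // eq_sym.
have /permP/(_ a) := cs r Ar; rewrite [LHS]permM rs [RHS]permM ra => /perm_inj/esym/eqP.
by rewrite (negPf xa).
Qed.

Variable gT : finGroupType.
Implicit Types V W : {group gT}.

Lemma Alt4_card V : V \isog 'Alt_('I_4) -> #|V| = 12.
Proof.
move/card_isog->; apply/eqP; rewrite -(eqn_pmul2l (isT : 0 < 2)).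
by rewrite card_Alt card_ord.
Qed.

Lemma Alt4_center V : V \isog 'Alt_('I_4) -> 'Z(V) = 1.
Proof.
move=> isoV; apply/eqP; rewrite trivg_card1.
rewrite (card_isog (isog_center (isoV : V \isog [group of 'Alt_('I_4)]))) /=.
by rewrite center_Alt4 cards1.
Qed.

(** If instead a subgroup [P] of order 3 were normal, an abelian Sylow subgroup [W] of order 4 would
    act on it through a group of order 2. The kernel would be nontrivial and central in [V] =
    [P * W], against the trivial center. *)
Lemma Alt4_normal_4subgroup V : V \isog 'Alt_('I_4) ->
  exists2 W : {group gT}, W <| V & #|W| = 4.
Proof.
move=> isoV; have oV := Alt4_card isoV; have Z1 := Alt4_center isoV.
have [[P nPV oP] | //] := order12_normal_Sylow oV.
have [W sylW] := Sylow_exists 2 V; have sWV := pHall_sub sylW.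
have oW : #|W| = 4 by rewrite (card_Hall sylW) oV p_part.
have nPW : W \subset 'N(P) := subset_trans sWV (normal_norm nPV).
have cWW : abelian W by apply: (@card_p2group_abelian _ 2).
have defV : P * W = V.
  apply/eqP; rewrite eqEcard mul_subG ?(normal_sub nPV) //= oV TI_cardMg ?oP ?oW //.
  by apply: coprime_TIg; rewrite oP oW.
have sCZ : 'C_W(P) \subset 'Z(V).
  rewrite subsetI subIset ?sWV //= -defV centM subsetI subsetIr.
  by rewrite (subset_trans (subsetIl _ _)).
have : #|W : 'C(P)| <= 2.
  have <- : #|Aut P| = 2 by rewrite card_Aut_cyclic ?oP // prime_cyclic ?oP.
  rewrite -(setIidPr nPW) -(ker_conj_aut P) -card_morphim.
  by rewrite subset_leq_card // Aut_conj_aut.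
rewrite Z1 in sCZ; rewrite -divgI (eqP (_ : 'C_W(P) == 1)) -?subG1 // cards1 oW //.
Qed.

End Alt4.

(** * The permutation representation on right cosets *)

Section CosetAction.

Variables (gT : finGroupType) (H U : {group gT}).

Lemma group_in_rcosets : (U : {set gT}) \in rcosets U H.
Proof. by apply/rcosetsP; exists 1; rewrite ?mulg1. Qed.

(** Right translation of cosets, transported to ordinals so that the image lands in a standard
    symmetric group. Elements outside [H] act as the identity because [is_action] asks for
    injectivity at every [x] of the ambient type. *)
Definition coset_index_act (i : 'I_(#|H : U|)) (x : gT) : 'I_(#|H : U|) :=
  if x \in H then enum_rank_in group_in_rcosets (enum_val i :* x) else i.

Lemma enum_val_coset_index_act i x : x \in H ->
  enum_val (coset_index_act i x) = enum_val i :* x.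
Proof.
move=> Hx; rewrite /coset_index_act Hx enum_rankK_in //.
case/rcosetsP: (enum_valP i) => y Hy ->; rewrite -rcosetM.
by apply/rcosetsP; exists (y * x); rewrite ?groupM.
Qed.

Lemma coset_index_act_is_action : is_action H coset_index_act.
Proof.
split=> [x i j | i x y Hx Hy].
  have [Hx | H'x] := boolP (x \in H); last by rewrite /coset_index_act (negPf H'x).
  move/(congr1 enum_val); rewrite !enum_val_coset_index_act // => eij.
  by apply: enum_val_inj; rewrite -[LHS](rcosetK x) /= eij rcosetK.
by apply: enum_val_inj; rewrite !enum_val_coset_index_act ?groupM ?rcosetM.
Qed.

(** The kernel of the coset action is the core of [U], so the action is faithful; equality of orders
    then makes it onto. *)
Lemma isog_Sym_gcore_trivial :
  gcore U H = 1 -> #|H| = (#|H : U|)`! -> H \isog [set: 'S_(#|H : U|)].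
Proof.
move=> core1 oH; pose to := Action coset_index_act_is_action.
have inj : 'injm (actperm to).
  apply/subsetP=> x /morphpreP[Hx /set1P px]; rewrite -core1 -astabRs_rcosets.
  apply/astabP=> X AX; rewrite /= rcosetE.
  have := enum_val_coset_index_act (enum_rank_in group_in_rcosets X) Hx.
  have -> : coset_index_act (enum_rank_in group_in_rcosets X) x =
            enum_rank_in group_in_rcosets X.
    by rewrite -[LHS](actpermE to) px perm1.
  by rewrite enum_rankK_in.
apply/isogP; exists (actperm_morphism to) => //.
by apply/eqP; rewrite eqEcard subsetT cardsT card_Sn card_injm // oH leqnn.
Qed.

End CosetAction.

(** * Groups generated by [U] and [V] under conditions (a) and (b) *)

Section Amalgams.

Variable gT : finGroupType.
Implicit Types (G H K L M N P S U V W X : {group gT}) (c t w x : gT).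

(** Since [U] normalizes [W], the product [U * W] is a group; it contains both generating subgroups,
    hence all of [G]. *)
Lemma join_normal_leq G U V W :
  U <*> V = G -> W <| G -> V \subset U * W -> #|G| <= #|U| * #|W|.
Proof.
move=> defG /andP[_ nWG] sVUW.
have sUG : U \subset G by rewrite -defG joing_subl.
have sG : G \subset U * W.
  have defUW := norm_joinEl (subset_trans sUG nWG).
  by rewrite -defUW -{1}defG join_subG joing_subl /= defUW.
by apply: leq_trans (subset_leq_card sG) _; rewrite mul_cardG leq_pmulr ?cardG_gt0.
Qed.

(** The order of the image of [x] in the quotient divides two coprime numbers. *)
Lemma mem_normal_coprime G N x :
  N <| G -> x \in G -> coprime #[x] #|G : N| -> x \in N.
Proof.
move=> nNG Gx co; have nNx : x \in 'N(N) := subsetP (normal_norm nNG) x Gx.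
apply: coset_idr => //; apply/eqP; rewrite -order_eq1 -dvdn1 -(eqP co) dvdn_gcd.
rewrite morph_order //= -card_quotient ?normal_norm //.
by rewrite order_dvdG ?mem_quotient.
Qed.

(** A normal Hall subgroup is the [pi]-core, hence characteristic. *)
Lemma Hall_normal_trans pi G H W :
  pi.-Hall(H) W -> W <| H -> H <| G -> W <| G.
Proof.
move=> hallW nWH nHG; rewrite -(normal_Hall_pcore hallW nWH).
exact: gFnormal_trans.
Qed.

Lemma no_normal_Sylow2_of_inverting G S c t :
    #|G| = 48 -> S <| G -> #|S| = 16 -> c \in G -> t \in G ->
    #[c] = 3 -> #[t] = 2 -> c ^ t = c^-1 -> False.
Proof.
move=> oG nSG oS Gc Gt oc ot ct.
have St : t \in S.
  by apply: (mem_normal_coprime nSG Gt); rewrite ot -(divgS (normal_sub nSG)) oG oS.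
have /order_dvdG : c \in S.
  by apply: (normal_inverting_mem oc ct _ St); apply: (subsetP (normal_norm nSG)).
by rewrite oc oS.
Qed.

Lemma Alt4_factorization V W c :
    #|V| = 12 -> W \subset V -> #|W| = 4 -> c \in V -> #[c] = 3 ->
  <[c]> * W = V.
Proof.
move=> oV sWV oW Vc oc; apply/eqP; rewrite eqEcard mul_subG ?cycle_subG //=.
rewrite TI_cardMg -?orderE ?oc ?oW ?oV //.
by apply: coprime_TIg; rewrite -orderE oc oW.
Qed.

(** Irreducibility of [c] on the Klein group: an invariant [X] of order 2 would be centralized by
    [c] and by the abelian [W], hence be central in [V]. *)
Lemma Alt4_invariant_subgroup V W c X :
    #|V| = 12 -> 'Z(V) = 1 -> W <| V -> #|W| = 4 -> c \in V -> #[c] = 3 ->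
    X \subset W -> c \in 'N(X) -> X :!=: 1 -> X :=: W.
Proof.
move=> oV Z1 nWV oW Vc oc sXW nXc ntX; have sWV := normal_sub nWV.
have cWW : abelian W by apply: (@card_p2group_abelian _ 2).
apply/eqP; rewrite eqEcard sXW oW leqNgt; apply/negP=> ltX.
have oX : #|X| = 2.
  have := cardSg sXW; have := cardG_gt1 X; rewrite ntX oW.
  by case: #|X| ltX => [|[|[|[|]]]].
have : X \subset 'Z(V).
  rewrite subsetI (subset_trans sXW) // centsC -(Alt4_factorization oV sWV oW Vc oc).
  apply: mul_subG; last exact: centsS sXW cWW.
  by apply: (norm_order2_cent oX); rewrite cycle_subG.
by rewrite Z1 subG1 (negPf ntX).
Qed.

Lemma cond_b_data U V : cond_b U V ->
  exists c t W, [/\ [/\ c \in U, c \in V, #[c] = 3, t \in U & #[t] = 2],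
    c ^ t = c^-1, <[c]> * <[t]> = U,
    [/\ #|U| = 6, #|V| = 12 & 'Z(V) = 1] & W <| V /\ #|W| = 4].
Proof.
case=> isoU isoV /card_isog; rewrite card_Zp //= => oI.
have [c /setIP[Uc Vc] oc] := cyclic_generator_prime (isT : prime 3) oI.
have oU := dihedral6_card isoU.
have [t Ut ot] : {t | t \in U & #[t] = 2} by apply: Cauchy; rewrite ?oU.
have [defU ct] := dihedral6_gen isoU Uc Ut oc ot.
have [W nWV oW] := Alt4_normal_4subgroup isoV.
exists c, t, W; split=> //; split=> //; [exact: Alt4_card | exact: Alt4_center].
Qed.

Lemma cond_a_data U V : cond_a U V ->
  exists c t, [/\ [/\ c \in U, #[c] = 3, t \in U, t \in V & #[t] = 2],
    c ^ t = c^-1, <[c]> * <[t]> = U, #|U| = 6 & #|V| = 4].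
Proof.
case=> isoU /card_isog; rewrite (@card_dihedral 2) // => oV.
move/card_isog; rewrite card_Zp //= => oI.
have [t /setIP[Ut Vt] ot] := cyclic_generator_prime (isT : prime 2) oI.
have oU := dihedral6_card isoU.
have [c Uc oc] : {c | c \in U & #[c] = 3} by apply: Cauchy; rewrite ?oU.
have [defU ct] := dihedral6_gen isoU Uc Ut oc ot.
by exists c, t.
Qed.

Lemma cond_b_leq24 G U V W c :
    U <*> V = G -> #|U| = 6 -> #|V| = 12 -> W <| V -> #|W| = 4 ->
    c \in U -> c \in V -> #[c] = 3 -> W <| G -> #|G| <= 24.
Proof.
move=> defG oU oV nWV oW Uc Vc oc nWG.
rewrite (leq_trans (join_normal_leq defG nWG _)) ?oU ?oW //.
rewrite -(Alt4_factorization oV (normal_sub nWV) oW Vc oc).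
by rewrite mulSg ?cycle_subG.
Qed.

Lemma no_cond_b_48 G U V : U <*> V = G -> #|G| = 48 -> ~ cond_b U V.
Proof.
move=> defG oG /cond_b_data[c [t [W]]].
case=> -[Uc Vc oc Ut ot] ct defU [oU oV Z1] [nWV oW].
have sUG : U \subset G by rewrite -defG joing_subl.
have sVG : V \subset G by rewrite -defG joing_subr.
have Gc := subsetP sUG c Uc; have Gt := subsetP sUG t Ut.
have sWV := normal_sub nWV; have sWG := subset_trans sWV sVG.
have nWc : c \in 'N(W) := subsetP (normal_norm nWV) c Vc.
have [[S nSG oS] | [K nKG oK]] := order48_normal_2subgroup oG.
  exact: (no_normal_Sylow2_of_inverting oG nSG oS Gc Gt oc ot ct).
have nKc : c \in 'N(K) := subsetP (normal_norm nKG) c Gc.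
have sWK : W \subset K.
  have sylW : 2.-Sylow(V) W by rewrite pHallE sWV oW oV p_part.
  have sIW : (V :&: K)%G \subset W.
    rewrite (sub_normal_Hall sylW nWV) ?subsetIl //.
    by apply: pgroupS (subsetIr V K) _; rewrite /pgroup oK.
  (* 12 * 8 > 48 makes the intersection nontrivial; irreducibility then identifies it with [W]. *)
  have := card_mulG_le sVG (normal_sub nKG); rewrite oV oK oG => leI.
  have <- : (V :&: K)%G :=: W.
    apply: (Alt4_invariant_subgroup oV Z1 nWV oW Vc oc sIW).
      by rewrite -cycle_subG normsI ?cycle_subG // (subsetP (normG V)).
    by rewrite -cardG_gt1 /=; case: #|V :&: K| leI => [|[|n]].
  exact: subsetIr.
have sWtK : W :^ t \subset K by rewrite -(normP (subsetP (normal_norm nKG) t Gt)) conjSg.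
have eW : (W :&: W :^ t)%G :=: W.
  apply: (Alt4_invariant_subgroup oV Z1 nWV oW Vc oc (subsetIl _ _)).
    (* [c] is the inverse of [c ^ t], which normalizes [W :^ t]. *)
    have nWtc : c \in 'N(W :^ t).
      by rewrite normJ -groupV -ct memJ_conjg.
    by rewrite -cycle_subG normsI ?cycle_subG.
  have := card_mulG_le sWK (sWtK : (W :^ t)%G \subset K).
  by rewrite cardJg oW oK -cardG_gt1 /=; case: #|W :&: W :^ t| => [|[|n]].
have nWt : t \in 'N(W).
  rewrite inE; have /eqP <- : W :==: W :^ t; last exact: subxx.
  by rewrite eqEcard cardJg leqnn andbT -{1}eW subsetIr.
have nWG : W <| G.
  rewrite /normal sWG -defG join_subG (normal_norm nWV) andbT.
  by rewrite -defU mul_subG ?cycle_subG.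
by have := cond_b_leq24 defG oU oV nWV oW Uc Vc oc nWG; rewrite oG.
Qed.

Lemma no_cond_b_72 G U V : U <*> V = G -> #|G| = 72 -> ~ cond_b U V.
Proof.
move=> defG oG /cond_b_data[c [t [W]]].
case=> -[Uc Vc oc Ut ot] ct defU [oU oV Z1] [nWV oW].
have sUG : U \subset G by rewrite -defG joing_subl.
have sVG : V \subset G by rewrite -defG joing_subr.
have Gc := subsetP sUG c Uc; have sWV := normal_sub nWV.
have sWG := subset_trans sWV sVG.
have nWc : c \in 'N(W) := subsetP (normal_norm nWV) c Vc.
have defV := Alt4_factorization oV sWV oW Vc oc.
have [[P nPG oP] | [L [nLG oL nCG oC]]] := order72_normal_3subgroup oG.
  have Pc : c \in P.
    by apply: (mem_normal_coprime nPG Gc); rewrite oc -(divgS (normal_sub nPG)) oG oP.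
  (* [W] and [V :&: P] are both normal in [V] and have coprime orders, so they commute. This makes
     [c] central in [V]. *)
  have cWP : W \subset 'C(V :&: P).
    apply/commG1P/trivgP; have <- : W :&: (V :&: P) = 1.
      apply: coprime_TIg; apply: (coprime_dvdr (cardSg (subsetIr V P))).
      by rewrite oW oP.
    apply: commg_subI; rewrite subsetI.
      rewrite subxx /= normsI ?(subset_trans sWV) ?normG //.
      exact: subset_trans sVG (normal_norm nPG).
    by rewrite subxx /= (subset_trans (subsetIl _ _)) ?normal_norm.
  have : c \in 'Z(V).
    rewrite inE Vc -defV centM inE cent_cycle cent1id /=.
    have Ic : c \in V :&: P by rewrite inE Vc.
    by move: cWP; rewrite centsC => /subsetP->.
  by rewrite Z1 => /set1P c1; rewrite c1 order1 in oc.
set C := 'C_G(L) in nCG oC.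
have sCG : C \subset G := normal_sub nCG.
have Cc : c \in C.
  apply: (mem_normal_coprime nCG Gc); rewrite oc -divgS //= oG.
  by case: oC => ->.
have sWC : W \subset C.
  have <- : (W :&: 'C_G(L))%G :=: W; last exact: subsetIr.
  apply: (Alt4_invariant_subgroup oV Z1 nWV oW Vc oc (subsetIl _ _)).
    rewrite -cycle_subG normsI ?cycle_subG //.
    exact: (subsetP (normal_norm nCG)).
  have := @card_mulG_le _ G W 'C_G(L)%G sWG sCG.
  by rewrite -cardG_gt1 oW oG /=; case: oC => ->; case: #|W :&: 'C_G(L)| => [|[|n]].
have sVC : V \subset C by rewrite -defV mul_subG ?cycle_subG.
have cVL : V \subset 'C(L) := subset_trans sVC (subsetIr _ _).
have tiVL : V :&: L = 1.
  rewrite setIC; apply: prime_TIg; rewrite ?oL //; apply/negP=> sLV.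
  have /subset_leq_card : L \subset 'Z(V) by rewrite subsetI sLV centsC.
  by rewrite oL Z1 cards1.
have defVL : V <*> L = V * L := cent_joinEl cVL.
have oVL : #|V <*> L| = 36 by rewrite defVL TI_cardMg // oV oL.
have sVLG : V <*> L \subset G by rewrite join_subG sVG normal_sub.
have nVLG : (V <*> L)%G <| G by apply: index2_normal; rewrite // -divgS //= oG oVL.
have nWVL : W <| (V <*> L)%G.
  rewrite /normal (subset_trans sWV) ?joing_subl //= join_subG normal_norm //=.
  by rewrite cents_norm // centsC (subset_trans sWV).
have hallW : 2.-Hall((V <*> L)%G) W.
  by rewrite pHallE normal_sub //= oW oVL p_part.
have nWG := Hall_normal_trans hallW nWVL nVLG.
by have := cond_b_leq24 defG oU oV nWV oW Uc Vc oc nWG; rewrite oG.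
Qed.

Lemma no_cond_a_72 G U V : U <*> V = G -> #|G| = 72 -> ~ cond_a U V.
Proof.
move=> defG oG /cond_a_data[c [t]].
case=> -[Uc oc Ut Vt ot] ct defU oU oV.
have sUG : U \subset G by rewrite -defG joing_subl.
have sVG : V \subset G by rewrite -defG joing_subr.
have Gc := subsetP sUG c Uc; have Gt := subsetP sUG t Ut.
(* If [c] lies in [N], then [U] lies in [N * V]; so a normal subgroup containing [c] has order at
   least 18. *)
have notNc N : N <| G -> c \in N -> 72 <= 4 * #|N|.
  move=> nNG Nc; have defG' : V <*> U = G by rewrite joingC.
  rewrite -oG -oV; apply: (join_normal_leq defG' nNG).
  rewrite (normC (subset_trans sVG (normal_norm nNG))).
  by rewrite -defU mulgSS ?cycle_subG.
have noP P : P <| G -> #|P| != 9.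
  move=> nPG; apply/eqP=> oP; have := notNc P nPG; rewrite oP.
  have -> // : c \in P; last by move/(_ isT).
  by apply: (mem_normal_coprime nPG Gc); rewrite oc -(divgS (normal_sub nPG)) oG oP.
(* Such a [W] misses [t], so [<[t]> <*> W] already has order 8, the largest possible for the 2-group
   [V <*> W]. The two coincide, [V] falls inside [U * W], and [G] has order at most 24. *)
have noW W : W <| G -> #|W| != 4.
  move=> nWG; apply/eqP=> oW; have sWG := normal_sub nWG.
  have nWt : <[t]> \subset 'N(W).
    by rewrite cycle_subG (subsetP (normal_norm nWG)).
  have nWV := subset_trans sVG (normal_norm nWG).
  have W't : t \notin W.
    apply/negP=> Wt; have /order_dvdG : c \in W; last by rewrite oc oW.
    by apply: (normal_inverting_mem oc ct _ Wt); apply: (subsetP (normal_norm nWG)).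
  have otW : #|<[t]> <*> W| = 8.
    rewrite norm_joinEl // TI_cardMg -?orderE ?ot ?oW //.
    by apply: prime_TIg; rewrite -?orderE ?ot // cycle_subG.
  have leVW : #|V <*> W| <= 8.
    have p2 : 2.-group (V <*> W) by rewrite norm_joinEl // pgroupM /pgroup oV oW.
    have := cardSg (_ : (V <*> W)%G \subset G); rewrite join_subG sVG => /(_ sWG).
    have /p_natP[n ->] := p2; rewrite oG pfactor_dvdn // => le_n.
    by rewrite (leq_exp2l _ 3).
  have stV : <[t]> <*> W \subset V <*> W by rewrite genS // setSU ?cycle_subG.
  have etV : <[t]> <*> W = V <*> W by apply/eqP; rewrite eqEcard stV otW.
  suff /(join_normal_leq defG nWG) : V \subset U * W by rewrite oG oU oW.
  apply: (subset_trans (joing_subl V W)); rewrite -etV norm_joinEl //.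
  by rewrite mulSg ?cycle_subG.
have [[P nPG oP] | [L [nLG oL nCG oC]]] := order72_normal_3subgroup oG.
  by case/eqP: (noP P nPG).
pose C := 'C_G(L)%G; have sCG : C \subset G := normal_sub nCG.
have Cc : c \in C.
  by apply: (mem_normal_coprime nCG Gc); rewrite oc -(divgS sCG) oG; case: oC => ->.
have cLC : C \subset 'C(L) := subsetIr _ _.
have cLL : abelian L by rewrite cyclic_abelian ?prime_cyclic ?oL.
have sLC : L \subset C by rewrite subsetI (normal_sub nLG).
have nLC : L <| C by rewrite /normal sLC cents_norm.
have L'c : c \notin L by apply/negP=> /(notNc L nLG); rewrite oL.
have tiLc : L :&: <[c]> = 1.
  by rewrite setIC; apply: prime_TIg; rewrite -?orderE ?oc // cycle_subG.
have nLc : <[c]> \subset 'N(L) by rewrite cycle_subG (subsetP (normal_norm nLC)).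
pose P := (L <*> <[c]>)%G; have defP : P :=: L * <[c]> by apply: norm_joinEr.
have oP : #|P| = 9 by rewrite defP TI_cardMg // -orderE oc oL.
have sPC : P \subset C by rewrite join_subG sLC cycle_subG.
(* [P] is a Sylow 3-subgroup of [C] in which [<[c]>] complements [L]; Gaschutz's theorem lifts this
   to a complement of [L] in [C]. *)
have coLP : coprime #|L| #|C : P|.
  by rewrite -(divgS sPC) oL oP; case: oC => ->.
have : [splits C, over L].
  rewrite (Gaschutz_split nLC (joing_subl _ _) sPC cLL coLP).
  by apply/splitsP; exists <[c]>%G; apply/complP.
case/splitsP=> M /complP[tiLM defC].
have sMC : M \subset C by rewrite -defC mulG_subr.
have nMC : M <| C.
  rewrite /normal sMC -defC mul_subG ?normG // cents_norm //.
  by rewrite centsC (subset_trans sMC).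
have oM : (3 * #|M|)%N = #|C| by rewrite -oL -TI_cardMg // defC.
case: oC => oC; rewrite oC in oM.
  have {}oM : #|M| = 12 by apply/eqP; rewrite -(eqn_pmul2l (isT : 0 < 3)) oM.
  have cLM : M \subset 'C(L) := subset_trans sMC cLC.
  have [[Q nQM oQ] | [W nWM oW]] := order12_normal_Sylow oM.
    have sQM := normal_sub nQM.
    have cLQ : Q \subset 'C(L) := subset_trans sQM cLM.
    have oLQ : #|L <*> Q| = 9.
      rewrite norm_joinEr ?cents_norm // TI_cardMg ?oL ?oQ //.
      by apply/trivgP; rewrite -tiLM setIS.
    have nLQC : (L <*> Q)%G <| C.
      rewrite /normal join_subG sLC (subset_trans sQM sMC) /=.
      rewrite normsY ?(normal_norm nLC) // -defC mul_subG ?(normal_norm nQM) //.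
      by rewrite cents_norm // centsC.
    have hallLQ : 3.-Hall(C) (L <*> Q)%G.
      by rewrite pHallE (normal_sub nLQC) /= oLQ oC p_part.
    by case/eqP: (noP _ (Hall_normal_trans hallLQ nLQC nCG)).
  have sWM := normal_sub nWM.
  have nWC : W <| C.
    rewrite /normal (subset_trans sWM sMC) -defC mul_subG ?(normal_norm nWM) //.
    by rewrite cents_norm // centsC (subset_trans sWM).
  have hallW : 2.-Hall(C) W by rewrite pHallE (normal_sub nWC) /= oW oC p_part.
  by case/eqP: (noW _ (Hall_normal_trans hallW nWC nCG)).
have {}oM : #|M| = 24 by apply/eqP; rewrite -(eqn_pmul2l (isT : 0 < 3)) oM.
have eCG : C :=: G by apply/eqP; rewrite eqEcard sCG oC oG.
have nMG : M <| G by rewrite -eCG.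
have sVM : V \subset M.
  apply/subsetP=> v Vv; apply: (mem_normal_coprime nMG (subsetP sVG v Vv)).
  rewrite -(divgS (normal_sub nMG)) oG oM; apply: (coprime_dvdl (order_dvdG Vv)).
  by rewrite oV.
have Mt := subsetP sVM t Vt.
have Mc : c \in M.
  by apply: (normal_inverting_mem oc ct _ Mt); apply: (subsetP (normal_norm nMG)).
have : G \subset M by rewrite -defG join_subG sVM andbT -defU mul_subG ?cycle_subG.
by move/subset_leq_card; rewrite oG oM.
Qed.

(* A nonabelian [K] would have a center of order 2; [c] would permute the three
   nontrivial cosets of the center transitively, and one of them contains the
   involution [w], so that [K] would have exponent 2. *)
Lemma order8_abelian_of_order3_action K c w :
    #|K| = 8 -> #[c] = 3 -> c \in 'N(K) -> w \in K -> w ^+ 2 = 1 ->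
    w ^ c != w -> abelian K.
Proof.
move=> oK oc nKc Kw w2 wc; apply/negPn/negP=> nabK.
have pK : 2.-group K by rewrite /pgroup oK.
have oZ : #|'Z(K)| = 2.
  apply: (card_center_extraspecial pK); apply: (p3group_extraspecial pK nabK).
  by rewrite oK.
have nZc : c \in 'N('Z(K)) by apply: subsetP nKc; apply: gFnorms.
have cZc : c \in 'C('Z(K)).
  by rewrite -sub1set; apply: norm_order2_cent oZ _; rewrite sub1set.
have Z'w : w \notin 'Z(K).
  apply: contra wc => Zw; apply/eqP/conjg_fixP/commgP; apply: commute_sym.
  exact: (centP cZc).
have nZK : K \subset 'N('Z(K)) := gFnorm _ _.
have c3 x : ((x ^ c) ^ c) ^ c = x.
  have ccc : c * (c * c) = 1 by rewrite -(expg_order c) oc !expgS expg0 mulg1.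
  by rewrite -!conjgM -?mulgA ccc conjg1.
have Kwc : w ^ c \in K by rewrite memJ_norm.
have Kwcc : (w ^ c) ^ c \in K by rewrite memJ_norm.
have Z'wc : w ^ c \notin 'Z(K) by rewrite memJ_norm.
have Z'wcc : (w ^ c) ^ c \notin 'Z(K) by rewrite memJ_norm.
have wcZ : w^-1 * w ^ c \notin 'Z(K).
  apply/negP=> Zy; set y := w^-1 * w ^ c in Zy.
  have yc : y ^ c = y by apply/conjg_fixP/commgP; apply: commute_sym; apply: (centP cZc).
  have y2 : y * y = 1.
    by have := order_dvdG Zy; rewrite oZ order_dvdn expgS expg1 => /eqP.
  have ewc : w ^ c = w * y by rewrite mulKVg.
  have e2 : (w ^ c) ^ c = w by rewrite ewc conjMg yc ewc -mulgA y2 mulg1.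
  by have := c3 w; rewrite e2; apply/eqP.
have xZ x y : x \in K -> y \in K -> coset 'Z(K) x = coset 'Z(K) y -> x^-1 * y \in 'Z(K).
  move=> /(subsetP nZK) nx /(subsetP nZK) ny exy; apply: coset_idr.
    by rewrite groupM ?groupV.
  by rewrite morphM ?groupV //= morphV //= exy mulVg.
pose q x := coset 'Z(K) x.
have q_neq1 x : x \in K -> x \notin 'Z(K) -> 1 != q x.
  move=> Kx; apply: contra; rewrite eq_sym => /eqP; apply: coset_idr.
  exact: (subsetP nZK).
have q_neq x : x \in K -> x ^ c \in K -> x^-1 * x ^ c \notin 'Z(K) -> q x != q (x ^ c).
  by move=> Kx Kxc; apply: contra => /eqP; apply: xZ.
have wccZ : (w ^ c)^-1 * (w ^ c) ^ c \notin 'Z(K) by rewrite -conjVg -conjMg memJ_norm.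
have wcccZ : ((w ^ c) ^ c)^-1 * ((w ^ c) ^ c) ^ c \notin 'Z(K).
  by rewrite -!conjVg -!conjMg !memJ_norm.
have defQ : [set 1; q w; q (w ^ c); q ((w ^ c) ^ c)] = K / 'Z(K).
  apply/eqP; rewrite eqEcard !subUset !sub1set group1 !mem_quotient //=.
  rewrite card_quotient // -divgS ?center_sub // oK oZ.
  rewrite -!setUA !cardsU1 cards1 !inE !negb_or !q_neq1 // !q_neq //=.
  by rewrite c3 in wcccZ; have := q_neq _ Kwcc; rewrite c3 eq_sym => ->.
have : 2.-abelem K.
  apply: exponent2_abelem; apply/exponentP=> x Kx.
  have mulZ u : u \in K -> u ^+ 2 = 1 -> q u = q x -> x ^+ 2 = 1.
    move=> Ku u2 /(xZ _ _ Ku Kx) Zy; rewrite -(mulKVg u x).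
    case/centerP: (Zy) => _ /(_ _ Ku) cuy.
    rewrite expgMn; last exact: commute_sym.
    by have := order_dvdG Zy; rewrite oZ order_dvdn u2 mul1g => /eqP.
  have : q x \in K / 'Z(K) by rewrite mem_quotient.
  rewrite -defQ !inE -!orbA => /or4P[] /eqP/esym.
  - rewrite -(morph1 (coset 'Z(K))); apply: mulZ; rewrite ?expg1n //.
  - exact: mulZ.
  - by apply: mulZ; rewrite // -conjXg w2 conj1g.
  - by apply: mulZ; rewrite // -!conjXg w2 !conj1g.
by move/abelem_abelian; rewrite (negPf nabK).
Qed.

Lemma cond_a_48_isog G U V :
  U <*> V = G -> #|G| = 48 -> cond_a U V -> G \isog setX [set: 'S_4] (Zp 2).
Proof.
move=> defG oG condUV; have [isoU _ _] := condUV; have [c [t]] := cond_a_data condUV.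
case=> -[Uc oc Ut Vt ot] ct defU oU oV.
have sUG : U \subset G by rewrite -defG joing_subl.
have sVG : V \subset G by rewrite -defG joing_subr.
have Gc := subsetP sUG c Uc; have Gt := subsetP sUG t Ut.
have [[S nSG oS] | [K nKG oK]] := order48_normal_2subgroup oG.
  by case: (no_normal_Sylow2_of_inverting oG nSG oS Gc Gt oc ot ct).
have sKG := normal_sub nKG; have nKG' := normal_norm nKG.
have nKc := subsetP nKG' c Gc.
have nKU := subset_trans sUG nKG'; have nKV := subset_trans sVG nKG'.
have K'c : c \notin K by apply/negP=> /order_dvdG; rewrite oc oK.
have K't : t \notin K.
  by apply: contra K'c; apply: (normal_inverting_mem oc ct).
(* [V <*> K] is a 2-group, so its order is at most 16 and the intersection has order at least 2; it
   is proper in [V] because it misses [t]. *)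
have oVK : #|V :&: K| = 2.
  have leVK : #|V <*> K| <= 16.
    have p2 : 2.-group (V <*> K) by rewrite norm_joinEl // pgroupM /pgroup oV oK.
    have := cardSg (_ : (V <*> K)%G \subset G); rewrite join_subG sVG => /(_ sKG).
    have /p_natP[n ->] := p2; rewrite oG pfactor_dvdn // => le_n.
    by rewrite (leq_exp2l _ 4).
  have := card_mulG_le (joing_subl V K) (joing_subr V K); rewrite oV oK => leI.
  have := cardSg (subsetIl V K); rewrite oV => dvdI.
  have ltI : #|V :&: K| < 4.
    rewrite -oV proper_card // properEneq subsetIl andbT.
    by apply: contra K't => /eqP eV; move: Vt; rewrite -eV => /setIP[].
  have {}leI : 4 * 8 <= 16 * #|V :&: K|.
    by apply: leq_trans leI _; rewrite leq_mul2r leVK orbT.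
  by case: #|V :&: K| dvdI leI ltI => [|[|[|[|n]]]].
have [w /setIP[Vw Kw] ow] := cyclic_generator_prime (isT : prime 2) oVK.
have defV : <[t]> * <[w]> = V.
  apply/eqP; rewrite eqEcard mul_subG ?cycle_subG //= oV.
  rewrite TI_cardMg -?orderE ?ot ?ow //; apply: prime_TIg; rewrite -?orderE ?ot //.
  by apply: contra K't; rewrite cycle_subG; apply: subsetP; rewrite cycle_subG.
have cVV : abelian V by apply: (@card_p2group_abelian _ 2).
have wt : w ^ t = w by apply/conjg_fixP/commgP; apply: (centsP cVV).
have sVUX (X : {group gT}) : w \in X -> V \subset U * X.
  by move=> Xw; rewrite -defV mulgSS ?cycle_subG.
(* Otherwise [G] would have order at most 6 * 2. As [t] fixes [w], it follows that [c] must move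
   [w]. *)
have not_nw : ~~ (<[w]>%G <| G).
  apply/negP=> nwG; have := join_normal_leq defG nwG (sVUX _ (cycle_id w)).
  by rewrite oG oU /= -orderE ow.
have wc : w ^ c != w.
  apply: contra not_nw => /eqP wc; rewrite /normal /= cycle_subG (subsetP sKG) //=.
  have cw x : w ^ x = w -> x \in 'N(<[w]>) by move=> wx; apply/normP; rewrite -cycleJ wx.
  have ww : w ^ w = w by rewrite conjgE mulKg.
  by rewrite -defG join_subG -defU -defV !mul_subG ?cycle_subG ?cw.
have w2 : w ^+ 2 = 1 by rewrite -ow expg_order.
have cKK := order8_abelian_of_order3_action oK oc nKc Kw w2 wc.
have defKU : K * U = G.
  apply/eqP; rewrite eqEsubset mul_subG //= -normC // -norm_joinEl // -defG.
  by rewrite join_subG joing_subl /= norm_joinEl //= sVUX.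
have tiKU : K :&: U = 1.
  apply/eqP; rewrite trivg_card1; have := mul_cardG K U.
  by rewrite defKU oG oK oU -[(8 * 6)%N]/(48 * 1)%N => /eqP; rewrite eqn_pmul2l // eq_sym.
pose C := <[c]>%G; have sCU : C \subset U by rewrite cycle_subG.
have oC : #|C| = 3 by rewrite -orderE.
have nCU : U \subset 'N(C).
  apply: normal_norm; apply: index2_normal => //; by rewrite -divgS // oU oC.
have nKC : C \subset 'N(K) := subset_trans sCU nKU.
have coKC : coprime #|K| #|C| by rewrite oK oC.
pose Z := 'C_K(C)%G; pose A := [~: K, C]%G.
have sZK : Z \subset K := subsetIl _ _.
have sAK : A \subset K by rewrite commg_subl.
have tiAZ : A :&: Z = 1.
  rewrite setIA (setIidPl sAK); exact: coprime_abel_cent_TI.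
(* Counting fixed points of [C] on [K] gives |Z| congruent to 8 modulo 3, so |Z| is 2 or 8; the
   latter fails because [c] moves [w]. *)
have oZ : #|Z| = 2.
  have p3 : 3.-group C by rewrite /pgroup oC.
  have actJ : [acts C, on K | 'J] by rewrite astabsJ.
  have := pgroup_fix_mod p3 actJ; rewrite afixJ oK -/Z => modZ.
  have dvdZ := cardSg sZK; rewrite oK in dvdZ.
  have : #|Z| \in divisors 8 by rewrite -dvdn_divisors.
  rewrite (_ : divisors 8 = [:: 1; 2; 4; 8]%N) // !inE.
  case/or4P=> /eqP oZ //; try by rewrite -[#|'C_K(C)|]/#|Z| oZ in modZ.
  have eZ : Z :=: K by apply/eqP; rewrite eqEcard sZK oK oZ.
  move: Kw; rewrite -eZ inE /= cent_cycle => /andP[_ /cent1P cwc].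
  by case/eqP: wc; apply/conjg_fixP/commgP.
have oA : #|A| = 4.
  have := cardSg sAK; rewrite oK => dvdA.
  have := subset_leq_card (mul_subG sAK sZK); rewrite TI_cardMg // oZ oK => leA.
  have : #|A| \in divisors 8 by rewrite -dvdn_divisors.
  rewrite (_ : divisors 8 = [:: 1; 2; 4; 8]%N) // !inE.
  case/or4P=> /eqP oA //; last by rewrite oA in leA.
    have /commG1P cKC : A :=: 1 by apply: card1_trivg.
    have /cent1P cwc : w \in 'C[c] by rewrite -cent_cycle (subsetP cKC).
    by case/eqP: wc; apply/conjg_fixP/commgP.
  have cAC : C \subset 'C(A) by apply: (norm_order2_cent oA); apply: commg_normr.
  have : A \subset A :&: Z by rewrite subsetI subxx subsetI sAK centsC.
  by rewrite tiAZ => /subset_leq_card; rewrite oA cards1.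
have cZU : U \subset 'C(Z).
  by apply: norm_order2_cent oZ _; rewrite normsI ?norms_cent.
have cZK : K \subset 'C(Z) by apply: centsS cKK.
have nAU : U \subset 'N(A) by apply: normsR.
pose H := (A <*> U)%G; have defH : H :=: A * U by apply: norm_joinEr.
have tiAU : A :&: U = 1 by apply/trivgP; rewrite -tiKU setSI.
have oH : #|H| = 24 by rewrite defH TI_cardMg // oA oU.
(* The modular law, since [K] meets [U] trivially. As [Z] lies in [K], the intersection of [H] with
   [Z] reduces to that of [A] with [Z]. *)
have defHK : H :&: K = A.
  by rewrite defH -group_modl // setIC tiKU mulg1.
have tiHZ : H :&: Z = 1.
  by rewrite -(setIidPr sZK) setIA defHK.
have sHG : H \subset G by rewrite join_subG (subset_trans sAK) ?sUG.
have cZH : Z \subset 'C(H).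
  by rewrite centsC join_subG (subset_trans sAK).
have defHZ : H \x Z = G.
  rewrite dprodE //; apply/eqP; rewrite eqEcard mul_subG //=; last first.
    exact: subset_trans sZK sKG.
  by rewrite oG TI_cardMg // oH oZ.
have sUH : U \subset H := joing_subr _ _.
have nAH : H \subset 'N(A) by rewrite join_subG normG.
have isoH : H \isog [set: 'S_4].
  have iHU : #|H : U| = 4 by rewrite -divgS // oH oU.
  rewrite -iHU; apply: isog_Sym_gcore_trivial; last by rewrite iHU oH.
  have sRU : gcore U H \subset U := gcore_sub _ _.
  have nRH : H \subset 'N(gcore U H) := gcore_norm _ _.
  (* The core and [A] normalize each other and meet trivially, so they commute; if [c] were in the
     core, [A] would lie in [Z]. *)
  have R'c : c \notin gcore U H.
    apply/negP=> Rc; have cAc : A \subset 'C(C).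
      rewrite centsC cycle_subG; apply: subsetP Rc; rewrite -/A.
      apply/commG1P/trivgP; rewrite -tiAU [A :&: U]setIC.
      apply: subset_trans (setSI A sRU); apply: commg_subI.
        by rewrite subsetI subxx (subset_trans sRU).
      rewrite subsetI subxx; exact: subset_trans (joing_subl A U) nRH.
    have : A \subset A :&: Z by rewrite subsetI subxx subsetI sAK.
    by rewrite tiAZ => /subset_leq_card; rewrite oA cards1.
  apply/eqP; rewrite trivg_card1; apply/negPn/negP=> ntR.
  (* A nontrivial core contains an element of order 2 or 3. An involution of [U] inverts [c], and an
     element of order 3 generates [C]; either way [c] would be in the core. *)
  have [p pr_p dvp] : exists2 p, prime p & p %| #|gcore U H|.
    by exists (pdiv #|gcore U H|); rewrite ?pdiv_dvd // pdiv_prime //;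
       rewrite ltn_neqAle eq_sym ntR cardG_gt0.
  have [x Rx ox] := Cauchy pr_p dvp.
  have Ux := subsetP sRU x Rx.
  have := order_dvdG Ux; rewrite ox oU => dvp6.
  have : p \in primes 6 by rewrite mem_primes pr_p.
  rewrite (_ : primes 6 = [:: 2; 3]%N) // !inE => /pred2P[] ep; rewrite ep in ox.
    have [_ cx] := dihedral6_gen isoU Uc Ux oc ox.
    case/negP: R'c; apply: (normal_inverting_mem oc cx _ Rx).
    exact: (subsetP nRH) (subsetP sUH c Uc).
  have Cx : x \in C.
    apply: (@mem_normal_coprime U C) => //.
      by rewrite /normal sCU.
    by rewrite ox -divgS // oU oC.
  have : <[x]> == C by rewrite eqEcard cycle_subG Cx oC -orderE ox.
  move/eqP=> eC; case/negP: R'c; have : c \in <[x]> by rewrite eC cycle_id.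
  by apply: subsetP; rewrite cycle_subG.
apply: (isog_dprod defHZ (setX_dprod [set: 'S_4]%G (Zp 2)%G)).
  exact: isog_trans isoH (isog_setX1 _ _).
apply: isog_trans (isog_set1X _ _).
rewrite isog_cyclic_card ?prime_cyclic ?oZ //= ?card_Zp //.
Qed.

End Amalgams.

Theorem theoremA1 (gT : finGroupType) (G U V : {group gT}) :
  U \subset G -> V \subset G -> U <*> V = G ->
  [/\ (#|G| = 48 -> cond_a U V -> G \isog setX [set: 'S_4] (Zp 2)),
      (#|G| = 48 -> ~ cond_b U V)
    & (#|G| = 72 -> ~ cond_a U V /\ ~ cond_b U V)].
Proof.
move=> _ _ defG; split=> oG.
- exact: cond_a_48_isog.
- exact: no_cond_b_48 defG oG.
by split; [apply: no_cond_a_72 defG oG | apply: no_cond_b_72 defG oG].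
Qed.
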